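(* Let $m,n\ge 1$ be integers, let $\xi^1,\dots,\xi^m$ be particles in a set $\mathsf{X}$ with weights $\omega^1,\dots,\omega^m\ge 0$, $\sum_{i=1}^m\omega^i=1$, and let $f:\mathsf{X}\to\mathbb{R}$ be a function. Let $\tilde\xi_{\mathrm{res}}^1,\dots,\tilde\xi_{\mathrm{res}}^n$ be obtained by residual resampling and $\tilde\xi_{\mathrm{mult}}^1,\dots,\tilde\xi_{\mathrm{mult}}^n$ by multinomial resampling from the same weighted particles. Then the conditional variance of residual resampling never exceeds that of multinomial resampling: $$\operatorname{Var}\Big[\tfrac1n\sum_{i=1}^n f(\tilde\xi_{\mathrm{res}}^i)\,\Big|\,\mathcal{G}\Big]\;\le\;\operatorname{Var}\Big[\tfrac1n\sum_{i=1}^n f(\tilde\xi_{\mathrm{mult}}^i)\,\Big|\,\mathcal{G}\Big].$$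
   Context: $\mathcal{G}$ denotes the $\sigma$-field with respect to which the particles $\xi^i$ and normalized weights $\omega^i$ are measurable; conditionally on $\mathcal{G}$ they are fixed and the only randomness is that of the resampling. Multinomial resampling: conditionally on $\mathcal{G}$, $\tilde\xi^1,\dots,\tilde\xi^n$ are i.i.d. from $\sum_{j=1}^m\omega^j\delta_{\xi^j}$, i.e. $\tilde\xi^i=\xi^{I^i}$ with $I^1,\dots,I^n$ conditionally i.i.d. and $\Pr(I^i=j\mid\mathcal{G})=\omega^j$. Residual resampling: let $R=\sum_{i=1}^m\lfloor n\omega^i\rfloor$. Particle $\xi^i$ is copied $N^i=\lfloor n\omega^i\rfloor+\bar N^i$ times, where, conditionally on $\mathcal{G}$, $(\bar N^1,\dots,\bar N^m)$ has the multinomial distribution with $n-R$ trials and probabilities $\bar\omega^i=(n\omega^i-\lfloor n\omega^i\rfloor)/(n-R)$, $i=1,\dots,m$ (if $R=n$, all $\bar N^i=0$). Equivalently, $\sum_{i=1}^n f(\tilde\xi^i)=\sum_{i=1}^m\lfloor n\omega^i\rfloor f(\xi^i)+\sum_{i=1}^{n-R}f(\xi^{\bar I^i})$ with $\bar I^1,\dots,\bar I^{n-R}$ conditionally i.i.d. and $\Pr(\bar I^i=j\mid\mathcal{G})=\bar\omega^j$. *)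

(* Defs.v *)
From HB Require Import structures.
From mathcomp Require Import all_boot all_order all_algebra.
From mathcomp Require Import all_classical all_reals all_analysis.

Set Implicit Arguments.
Unset Strict Implicit.
Unset Printing Implicit Defensive.

Import Order.TTheory GRing.Theory Num.Theory.
Import numFieldNormedType.Exports.

Local Open Scope classical_set_scope.
Local Open Scope ring_scope.

Section conditional_expectation.
Context {d : measure_display} {T : measurableType d} {R : realType}.
Variables (P : probability T R) (G : set (set T)).

Definition sub_sigma_field : Prop :=
  sigma_algebra [set: T] G /\ (forall A, G A -> measurable A).

Definition measurable_wrt (Y : T -> R) : Prop :=
  forall B : set R, measurable B -> G (Y @^-1` B).

(* [Y] is a version of E[Z | G]. The second clause only asks [Z] to be
   sigma-integrable with respect to [G] (Z is integrable on each member of a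
   countable cover of the space by sets of [G]), so that no moment condition is
   imposed on G-measurable quantities. If [Z] is integrable, taking
   A = setT in the last clause gives the usual definition. Versions are unique
   almost surely. *)
Definition is_cond_exp (Z Y : T -> R) : Prop :=
  [/\ measurable_wrt Y,
      exists A : nat -> set T,
        [/\ forall k, G (A k), \bigcup_k A k = [set: T] &
            forall k, P.-integrable (A k) (EFin \o Z)] &
      forall A, G A -> P.-integrable A (EFin \o Z) ->
        P.-integrable A (EFin \o Y) /\
        (\int[P]_(t in A) (Y t)%:E = \int[P]_(t in A) (Z t)%:E)%E].

(* A chosen version; the default value 0 is used only when there is none. *)
Definition cond_exp (Z : T -> R) : T -> R :=
  xget (fun=> 0) [set Y | is_cond_exp Z Y].

Definition cond_var (Z : T -> R) : T -> R :=
  cond_exp (fun t => (Z t - cond_exp Z t) ^+ 2).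

(* [p] is a version of P(E | G). *)
Definition is_cond_prob (E : set T) (p : T -> R) : Prop :=
  is_cond_exp (\1_E) p.

(* The events {I^i \in B^i} satisfy the product rule for all choices of the
   B^i; subfamilies are covered by taking B^i to be the full set. *)
Definition cond_independent (m n : nat) (I : 'I_n -> T -> 'I_m) : Prop :=
  forall (B : 'I_n -> {set 'I_m}) (p : 'I_n -> T -> R),
    (forall i, is_cond_prob [set t | I i t \in B i] (p i)) ->
    is_cond_prob [set t | forall i, I i t \in B i]
                 (fun t => \prod_(i < n) p i t).

End conditional_expectation.

(* Probability that N independent trials with cell probabilities p produce the
   counts k. *)
Definition multinomial_pmf {R : realType} (m N : nat) (p : 'I_m -> R)
    (k : 'I_m -> nat) : R :=
  if (\sum_(j < m) k j)%N == N
  then N`!%:R / (\prod_(j < m) (k j)`!)%N%:R * \prod_(j < m) p j ^+ k j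
  else 0.

Section resampling.
Context {d : measure_display} {T : measurableType d} {R : realType}.
Variables (P : probability T R) (G : set (set T)) (m n : nat).
Variable w : 'I_m -> T -> R.

(* Floor of n * w^j; [Num.truncn] is the floor on nonnegative reals. *)
Definition floor_copies (j : 'I_m) (t : T) : nat := Num.truncn (n%:R * w j t).

Definition nb_floor (t : T) : nat := (\sum_(j < m) floor_copies j t)%N.

(* When nb_floor t = n the division is by zero and the value 0 is irrelevant:
   the multinomial distribution below then has no trials. *)
Definition residual_weight (t : T) (j : 'I_m) : R :=
  (n%:R * w j t - (floor_copies j t)%:R) / (n - nb_floor t)%N%:R.

(* [I i t] is the label of the particle copied into position [i]. *)
Definition multinomial_resampling (I : 'I_n -> T -> 'I_m) : Prop :=
  (forall i j, is_cond_prob P G [set t | I i t = j] (w j)) /\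
  cond_independent P G I.

(* Only the number of copies of each particle is prescribed, not the positions
   of the copies among the n resampled particles. *)
Definition residual_resampling (I : 'I_n -> T -> 'I_m) : Prop :=
  exists Nbar : 'I_m -> T -> nat,
    (forall t j,
       #|[pred i | I i t == j]| = (floor_copies j t + Nbar j t)%N) /\
    (forall k : 'I_m -> nat,
       is_cond_prob P G [set t | forall j, Nbar j t = k j]
         (fun t => multinomial_pmf (n - nb_floor t) (residual_weight t) k)).

End resampling.

Definition resampled {T X : Type} (m n : nat) (xi : 'I_m -> T -> X)
    (I : 'I_n -> T -> 'I_m) (i : 'I_n) (t : T) : X := xi (I i t) t.

Definition empirical_mean {R : realType} {T X : Type} (n : nat) (f : X -> R)
    (x : 'I_n -> T -> X) (t : T) : R :=
  n%:R^-1 * \sum_(i < n) f (x i t).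

(* Main.v *)
Require Import Defs.
From mathcomp Require Import all_boot all_order all_algebra.
From mathcomp Require Import all_classical all_reals all_analysis.
From mathcomp Require Import measurable_realfun ring zify.

Set Implicit Arguments.
Unset Strict Implicit.
Unset Printing Implicit Defensive.

Import Order.TTheory GRing.Theory Num.Theory.
Import numFieldNormedType.Exports HBNNSimple.

Local Open Scope classical_set_scope.
Local Open Scope ring_scope.

(** Conditionally on G, the empirical mean is a function g(K) of a finite-valued
variable K (the word of labels, resp. the vector of residual counts), with
coefficients measurable with respect to G, so its conditional variance is almost
surely the variance of g under the conditional law of K. For multinomial
resampling this is 1/n^2 times n Var_w(f); for residual resampling only the
N = n - R residual draws are random, and it is 1/n^2 times N Var_p(f), where p
are the residual weights. With a the mean of f under w,
N Var_p(f) <= sum_j N p_j (f_j - a)^2 <= sum_j n w_j (f_j - a)^2 = n Var_w(f),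
because N p_j is the fractional part of n w_j. *)

(** * Variance of a function on a finite set *)

Definition weighted_var {R : realType} (S : finType) (q g : S -> R) : R :=
  \sum_s q s * (g s - \sum_u q u * g u) ^+ 2.

Section weighted_var_theory.
Context {R : realType} {S : finType}.
Implicit Types q g : S -> R.

Lemma weighted_var_ge0 q g : (forall s, 0 <= q s) -> 0 <= weighted_var q g.
Proof.
by move=> q0; apply: sumr_ge0 => s _; rewrite mulr_ge0 ?sqr_ge0.
Qed.

(** Expanding around the mean kills the cross term because the weights sum to 1. With [c = 0] it
    recovers a variance from two moments; with [c] the mean under another law it bounds a variance
    from above. *)
Lemma weighted_second_moment q g c : \sum_s q s = 1 ->
  \sum_s q s * (g s - c) ^+ 2 = weighted_var q g + (\sum_s q s * g s - c) ^+ 2.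
Proof.
move=> q1; rewrite /weighted_var; set a := \sum_s q s * g s.
have -> : \sum_s q s * (g s - c) ^+ 2 = \sum_s (q s * (g s - a) ^+ 2
    + ((2 * (a - c)) * (q s * g s) + (c ^+ 2 - a ^+ 2) * q s)).
  by apply: eq_bigr => s _; ring.
by rewrite !big_split/= -!mulr_sumr q1 -/a; ring.
Qed.

End weighted_var_theory.

(** * Moments of the multinomial distribution *)

Section multinomial_law.
Context {R : realType} {m : nat}.
Implicit Types (p : 'I_m -> R) (k : 'I_m -> nat).

Lemma multinomial_pmf_ge0 N p k : (forall j, 0 <= p j) ->
  0 <= multinomial_pmf N p k.
Proof.
move=> p0; rewrite /multinomial_pmf; case: ifP => // _.
by rewrite mulr_ge0 ?divr_ge0 ?ler0n// prodr_ge0// => j _; rewrite exprn_ge0.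
Qed.

(* Conditioning on the outcome j of the last trial. *)
Lemma multinomial_pmf_recl N p k :
  multinomial_pmf N.+1 p k =
  \sum_(j | (0 < k j)%N) p j * multinomial_pmf N p (fun i => k i - (i == j))%N.
Proof.
have sumB j : (0 < k j)%N ->
    (\sum_(i < m) k i = (\sum_(i < m) (k i - (i == j))%N).+1)%N.
  move=> kj; rewrite (bigD1 j)//= [in RHS](bigD1 j)//= eqxx subn1 -addSn prednK//.
  by congr addn; apply: eq_bigr => i /negbTE ->; rewrite subn0.
rewrite {1}/multinomial_pmf; case: eqP => [sumk|sumk]; last first.
  rewrite big1// => j kj; rewrite /multinomial_pmf.
  by case: eqP => [e|_]; [case: sumk; rewrite (sumB j)// e|rewrite mulr0].
set A := \prod_(j < m) p j ^+ k j; set D := (\prod_(j < m) (k j)`!)%N.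
have D0 : D%:R != 0 :> R.
  by rewrite pnatr_eq0 -lt0n prodn_gt0// => i; rewrite fact_gt0.
rewrite (eq_bigr (fun j => N`!%:R / D%:R * A * (k j)%:R)) => [|j kj].
  rewrite -mulr_sumr big_mkcond/=.
  rewrite (eq_bigr (fun j => (k j)%:R)) => [|j _]; last by case: (k j).
  by rewrite -natr_sum sumk factS natrM; ring.
rewrite /multinomial_pmf -(eqn_add2r 1) !addn1 -sumB// sumk eqxx.
have -> : A = p j * \prod_(i < m) p i ^+ (k i - (i == j)).
  rewrite /A (bigD1 j)//= [in RHS](bigD1 j)//= eqxx subn1 mulrA -exprS prednK//.
  by congr (_ * _); apply: eq_bigr => i /negbTE ->; rewrite subn0.
set D' := (\prod_(i < m) (k i - (i == j))`!)%N.
have DE : D = (k j * D')%N.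
  rewrite /D /D' (bigD1 j)//= [in RHS](bigD1 j)//= eqxx subn1 mulnA.
  rewrite -{2}(prednK kj) -factS prednK//.
  by congr muln; apply: eq_bigr => i /negbTE ->; rewrite subn0.
move: D0; rewrite DE natrM mulf_eq0 negb_or => /andP[kj0 D'0].
by field; rewrite kj0 D'0.
Qed.

(* Counts are bounded by an auxiliary M >= N, fixed during inductions on N, so
   as to have a finite index type. *)
Definition multinomial_mean (M N : nat) p (F : ('I_m -> nat) -> R) : R :=
  \sum_(k : {ffun 'I_m -> 'I_M.+1})
    multinomial_pmf N p (fun j => k j) * F (fun j => k j).

(** After [multinomial_pmf_recl] and an exchange of sums, each inner sum is reindexed by adding one
    to the count of [j]. The bound [N < M] leaves room for that extra unit in ['I_M.+1]. *)
Lemma multinomial_mean_recl M N p F : (N < M)%N ->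
  multinomial_mean M N.+1 p F =
  \sum_j p j * multinomial_mean M N p (fun k => F (fun i => k i + (i == j))%N).
Proof.
rewrite /multinomial_mean => NM.
under eq_bigr do rewrite multinomial_pmf_recl mulr_suml big_mkcond/=.
rewrite exchange_big/=; apply: eq_bigr => j _.
rewrite -big_mkcond/= mulr_sumr.
pose up (k : {ffun 'I_m -> 'I_M.+1}) : {ffun 'I_m -> 'I_M.+1} :=
  [ffun i => inord (k i + (i == j))%N].
pose dn (k : {ffun 'I_m -> 'I_M.+1}) : {ffun 'I_m -> 'I_M.+1} :=
  [ffun i => inord (k i - (i == j))%N].
(* A count equal to [M] cannot be raised, but such a vector has total above [N], hence mass 0. *)
rewrite [RHS](bigID (fun k : {ffun 'I_m -> 'I_M.+1} => (k j < M)%N))/=.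
rewrite [X in _ = _ + X]big1 ?addr0; last first.
  move=> k; rewrite -leqNgt => kj; rewrite /multinomial_pmf.
  case: eqP => [e|_]; last by rewrite mul0r mulr0.
  by move: NM; rewrite -e (bigD1 j)//= ltnNge (leq_trans kj)// leq_addr.
rewrite (reindex_onto up dn)/=; last first.
  move=> k kj; apply/ffunP => i; rewrite !ffunE; apply: val_inj.
  have ki : (k i - (i == j) < M.+1)%N by rewrite (leq_ltn_trans (leq_subr _ _)).
  rewrite [X in inord (X + _)%N](_ : _ = (k i - (i == j))%N); last exact: inordK.
  by rewrite subnK ?inord_val//; case: (i =P j) => [->|_].
have up_val (k : {ffun 'I_m -> 'I_M.+1}) : (k j < M)%N ->
    forall i, up k i = (k i + (i == j))%N :> nat.
  move=> kj i; rewrite ffunE inordK//; case: eqP => [->|_]; first by rewrite addn1.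
  by rewrite addn0.
have kjE (k : {ffun 'I_m -> 'I_M.+1}) :
    (0 < up k j)%N && (dn (up k) == k) = (k j < M)%N.
  (* If [k j = M], then [inord (M + 1)] is out of range. Whatever value it takes is at most [M], so
     lowering it by one cannot give back [M], which is positive. *)
  apply/andP/idP => [[upk /eqP e]|kj].
    rewrite ltnNge; apply/negP => kj.
    have kjM : k j = M :> nat.
      by apply/eqP; rewrite eqn_leq kj -ltnS ltn_ord.
    move/ffunP : e => /(_ j); rewrite !ffunE eqxx => /(congr1 val)/=.
    rewrite inordK; last by rewrite (leq_ltn_trans (leq_subr _ _)).
    move=> e; exfalso.
    have := ltn_ord (inord (k j + 1) : 'I_M.+1); move: e; rewrite kjM.
    move: (nat_of_ord (inord (M + 1))) => x /=; lia.
  split; first by rewrite up_val// eqxx addn1.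
  apply/eqP/ffunP => i; rewrite ffunE; apply: val_inj.
  by rewrite /= up_val// addnK inord_val.
apply: eq_big => // k; rewrite kjE => kj; rewrite -mulrA.
have -> : (fun i => up k i : nat) = (fun i => k i + (i == j))%N.
  by apply/funext => i; rewrite up_val.
congr (_ * (multinomial_pmf N p _ * _)).
by apply/funext => i; rewrite up_val// addnK.
Qed.

Lemma multinomial_mean0 M p F : multinomial_mean M 0 p F = F (fun=> 0%N).
Proof.
rewrite /multinomial_mean (bigD1 [ffun=> ord0])//= big1 ?addr0 => [|k k0].
  have -> : (fun j : 'I_m => nat_of_ord ([ffun=> (ord0 : 'I_M.+1)] j)) = (fun=> 0%N).
    by apply/funext => j; rewrite ffunE.
  by rewrite /multinomial_pmf !big1// eqxx divr1 !mul1r.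
rewrite /multinomial_pmf; case: ifP; rewrite ?mul0r// sum_nat_eq0 => /forallP k00.
case/eqP: k0; apply/ffunP => j; rewrite ffunE; apply: val_inj => /=.
exact/eqP/(implyP (k00 j)).
Qed.

Section moments.
Variables (M N : nat) (p h : 'I_m -> R).
Hypotheses (NM : (N <= M)%N) (p1 : (0 < N)%N -> \sum_j p j = 1).

(** The free constant [c] makes this family stable under adding one copy of [j], which only turns
    [c] into [c + h j]; the inductions on the number of trials rest on this. *)
Let L c (k : 'I_m -> nat) := c + \sum_j (k j)%:R * h j.

Let L0 c : L c (fun=> 0%N) = c.
Proof. by rewrite /L big1 ?addr0// => j _; rewrite mul0r. Qed.

Let LS c j k : L c (fun i => k i + (i == j))%N = L (c + h j) k.
Proof.
rewrite /L -addrA; congr (_ + _); under eq_bigr do rewrite natrD mulrDl.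
rewrite big_split/= addrC; congr (_ + _).
by rewrite (bigD1 j)//= eqxx mul1r big1 ?addr0// => i /negbTE ->; rewrite mul0r.
Qed.

Lemma multinomial_mean1 : multinomial_mean M N p (fun=> 1) = 1.
Proof.
elim: N NM p1 => [|N' IHN] N'M p1'; first by rewrite multinomial_mean0.
rewrite multinomial_mean_recl// (IHN (ltnW N'M) (fun=> p1' isT)).
by rewrite -mulr_suml p1'// mulr1.
Qed.

Lemma multinomial_mean_linear c :
  multinomial_mean M N p (fun k => c + \sum_j (k j)%:R * h j) =
  c + N%:R * \sum_j p j * h j.
Proof.
rewrite -/(L c); elim: N NM p1 c => [|N' IHN] N'M p1' c.
  by rewrite multinomial_mean0 L0 mul0r addr0.
rewrite multinomial_mean_recl//; set a := \sum_j p j * h j.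
rewrite (eq_bigr (fun j => (c + N'%:R * a) * p j + p j * h j)) => [|j _].
  by rewrite big_split/= -mulr_sumr p1'// -/a -natr1; ring.
rewrite (_ : (fun k => _) = L (c + h j)); last by apply/funext => k; exact: LS.
by rewrite (IHN (ltnW N'M) (fun=> p1' isT)) -/a; ring.
Qed.

Lemma multinomial_mean_sqr c :
  multinomial_mean M N p (fun k => (c + \sum_j (k j)%:R * h j) ^+ 2) =
  (c + N%:R * \sum_j p j * h j) ^+ 2 + N%:R * weighted_var p h.
Proof.
have -> : (fun k => (c + \sum_j (k j)%:R * h j) ^+ 2) =
    (fun k => L c k ^+ 2) by [].
elim: N NM p1 c => [|N' IHN] N'M p1' c.
  by rewrite multinomial_mean0 L0 !mul0r !addr0.
rewrite multinomial_mean_recl//; set a := \sum_j p j * h j.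
set v := weighted_var p h.
(* The square given by the induction hypothesis is read as a squared deviation of [h j] from
   [- c - N' a], so averaging over [j] adds one more variance [v]. *)
rewrite (eq_bigr (fun j => p j * (h j - (- c - N'%:R * a)) ^+ 2
    + (N'%:R * v) * p j)) => [|j _].
  rewrite big_split/= weighted_second_moment ?p1'// -mulr_sumr p1'//.
  by rewrite -/a -/v -natr1; ring.
rewrite (_ : (fun k => _) = (fun k => L (c + h j) k ^+ 2)); last first.
  by apply/funext => k; rewrite LS.
by rewrite (IHN (ltnW N'M) (fun=> p1' isT)) -/a -/v; ring.
Qed.

End moments.

(** Second moment minus squared mean. The constant [c] stands for the deterministic copies and [b]
    for the factor 1/n. The sum of [p] is constrained only for [N > 0], since residual weights with
    no trial left are all 0. *)
Lemma multinomial_var M N p (h : 'I_m -> R) (b c : R) :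
  (N <= M)%N -> ((0 < N)%N -> \sum_j p j = 1) ->
  weighted_var (fun k : {ffun 'I_m -> 'I_M.+1} => multinomial_pmf N p (fun j => k j))
    (fun k : {ffun 'I_m -> 'I_M.+1} =>
      b * (c + \sum_j (k j)%:R * h j)) = b ^+ 2 * (N%:R * weighted_var p h).
Proof.
move=> NM p1.
have m1 : \sum_(k : {ffun 'I_m -> 'I_M.+1}) multinomial_pmf N p (fun j => k j) = 1.
  rewrite -[RHS](multinomial_mean1 NM p1).
  by apply: eq_bigr => k _; rewrite mulr1.
have mL : \sum_(k : {ffun 'I_m -> 'I_M.+1}) multinomial_pmf N p (fun j => k j) *
    (b * (c + \sum_j (k j)%:R * h j)) = b * (c + N%:R * \sum_j p j * h j).
  rewrite -(multinomial_mean_linear h NM p1) mulr_sumr.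
  by apply: eq_bigr => k _; rewrite mulrCA.
have := weighted_second_moment (fun k : {ffun 'I_m -> 'I_M.+1} =>
  b * (c + \sum_j (k j)%:R * h j)) 0 m1.
rewrite mL; under eq_bigr do rewrite subr0 exprMn mulrCA.
rewrite -mulr_sumr.
rewrite -/(multinomial_mean M N p (fun k => (c + \sum_j (k j)%:R * h j) ^+ 2)).
rewrite multinomial_mean_sqr// => /eqP; rewrite subr0 exprMn mulrDr.
by rewrite addrC => /eqP/addIr ->.
Qed.

End multinomial_law.

(** * Independent draws, as product weights on words *)

Section words.
Context {R : realType} {m n : nat}.
Implicit Types w g : 'I_m -> R.

Let E w (F : {ffun 'I_n -> 'I_m} -> R) := \sum_(s : {ffun 'I_n -> 'I_m})
  (\prod_i w (s i)) * F s.

(** Independence of the letters is distributivity of the product over the sums. *)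
Let E_prod w (W : 'I_n -> 'I_m -> R) :
  E w (fun s => \prod_i W i (s i)) = \prod_i \sum_j w j * W i j.
Proof.
rewrite /E bigA_distr_bigA/=.
by apply: eq_bigr => s _; rewrite -big_split.
Qed.

Lemma word_weights_sum1 w : \sum_j w j = 1 ->
  \sum_(s : {ffun 'I_n -> 'I_m}) \prod_i w (s i) = 1.
Proof. by move=> w1; rewrite -(bigA_distr_bigA (fun=> w))/= big1. Qed.

Let E1 w g i : \sum_j w j = 1 -> E w (fun s => g (s i)) = \sum_j w j * g j.
Proof.
(* A function of one letter becomes a product over all letters, with factor 1 away from [i]. *)
move=> w1; transitivity (E w (fun s => \prod_l (if l == i then g (s l) else 1))).
  by apply: eq_bigr => s _; rewrite -big_mkcond/= big_pred1_eq.
rewrite (E_prod w (fun l j => if l == i then g j else 1)) (bigD1 i)//= eqxx.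
rewrite [X in _ * X]big1 ?mulr1// => l /negbTE ->.
by under eq_bigr do rewrite mulr1.
Qed.

Let E2 w g i i' : \sum_j w j = 1 -> \sum_j w j * g j = 0 -> i != i' ->
  E w (fun s => g (s i) * g (s i')) = 0.
Proof.
move=> w1 g0 ii'.
transitivity (E w (fun s => \prod_l (if l == i then g (s l) else
    if l == i' then g (s l) else 1))).
  apply: eq_bigr => s _; congr (_ * _); rewrite [RHS](bigD1 i)//= eqxx.
  congr (_ * _); rewrite [RHS](bigD1 i')/= 1?eq_sym// (negbTE ii') eqxx.
  by rewrite big1 ?mulr1// => l /andP[/negbTE -> /negbTE ->].
rewrite (E_prod w (fun l j => if l == i then g j else
  if l == i' then g j else 1)).
by rewrite (bigD1 i)//= eqxx g0 mul0r.
Qed.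

(** The square of the centred sum is a double sum over positions: distinct positions are
    uncorrelated by [E2], and each of the n diagonal terms is one variance. *)
Lemma word_var w g (b : R) : \sum_j w j = 1 ->
  weighted_var (fun s : {ffun 'I_n -> 'I_m} => \prod_i w (s i))
    (fun s => b * \sum_i g (s i)) = b ^+ 2 * (n%:R * weighted_var w g).
Proof.
move=> w1; rewrite {1}/weighted_var.
have -> : \sum_(s : {ffun 'I_n -> 'I_m}) \prod_i w (s i) * (b * \sum_i g (s i))
    = b * (n%:R * \sum_j w j * g j).
  under eq_bigr do rewrite mulrCA mulr_sumr.
  rewrite -mulr_sumr exchange_big/=; congr (_ * _).
  under eq_bigr do rewrite -/(E w (fun s => g (s _))) E1//.
  by rewrite sumr_const card_ord mulr_natl.
rewrite /weighted_var; set a := \sum_j w j * g j; pose G j := g j - a.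
have G0 : \sum_j w j * G j = 0.
  under eq_bigr do rewrite mulrBr.
  by rewrite sumrB -/a -mulr_suml w1 mul1r subrr.
transitivity (b ^+ 2 * \sum_i \sum_i' E w (fun s => G (s i) * G (s i'))).
  rewrite /E; under [in RHS]eq_bigr do rewrite exchange_big/=.
  rewrite exchange_big/= [RHS]mulr_sumr; apply: eq_bigr => s _.
  have -> : b * (\sum_i g (s i)) - b * (n%:R * a) = b * \sum_i G (s i).
    rewrite /G sumrB sumr_const card_ord; ring.
  rewrite exprMn mulrCA; congr (_ * _).
  rewrite expr2 mulr_suml mulr_sumr; apply: eq_bigr => i _.
  by rewrite !mulr_sumr.
congr (_ * _); rewrite mulr_natl -[n in RHS]card_ord -sumr_const.
apply: eq_bigr => i _; rewrite (bigD1 i)//= big1 ?addr0 => [|i' ii']; last first.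
  by rewrite E2// eq_sym.
by rewrite (E1 (fun j => G j * G j)).
Qed.

End words.

(** * Comparison of the two variances *)

Lemma weighted_var_residual (R : realType) (m : nat) (N c : R) (p w h : 'I_m -> R) :
  0 <= N -> 0 <= c -> (forall j, 0 <= w j) -> \sum_j w j = 1 ->
  (0 < N -> \sum_j p j = 1) -> (forall j, N * p j <= c * w j) ->
  N * weighted_var p h <= c * weighted_var w h.
Proof.
move=> N0 c0 w0 w1 p1 pw.
move: N0; rewrite le_eqVlt => /predU1P[<-|N0].
  by rewrite mul0r mulr_ge0// weighted_var_ge0.
set a := \sum_j w j * h j.
have -> : weighted_var w h = \sum_j w j * (h j - a) ^+ 2 by [].
have := weighted_second_moment h a (p1 N0) => /(congr1 ( *%R N)) e.
apply: (@le_trans _ _ (N * \sum_j p j * (h j - a) ^+ 2)).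
  (* The second moment about [a] exceeds the variance by the square of the difference of the two
     means. *)
  by rewrite e ler_pM2l// lerDl sqr_ge0.
rewrite !mulr_sumr; apply: ler_sum => j _.
by rewrite mulrA [c * _]mulrA ler_wpM2r ?sqr_ge0 ?pw.
Qed.

(** * Conditional expectation given a sub-sigma-field *)

Section sub_sigma_field_theory.
Context {d : measure_display} {T : measurableType d} {R : realType}.
Variables (P : probability T R) (G : set (set T)).
Hypothesis hG : sub_sigma_field G.

(** The same set with [G] as its measurable sets, so that measurability with respect to [G] becomes
    ordinary measurability. *)
Let TG := g_sigma_algebraType G.

Lemma sub_sigma_field_measurableE (A : set T) :
  G A = measurable (A : set TG).
Proof. by rewrite measurable_g_measurableTypeE//; exact: hG.1. Qed.

Lemma sub_sigma_fieldS A : G A -> measurable A. Proof. exact: hG.2. Qed.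

Lemma measurable_wrtP (Y : T -> R) :
  measurable_wrt G Y <-> measurable_fun [set: TG] Y.
Proof.
split=> [mY _ B mB|mY B mB].
  by rewrite setTI -sub_sigma_field_measurableE; exact: mY.
by rewrite sub_sigma_field_measurableE -[X in measurable X]setTI; exact: mY.
Qed.

Lemma measurable_wrt_measurable (Y : T -> R) (D : set T) :
  measurable_wrt G Y -> measurable_fun D Y.
Proof.
move=> mY; apply: measurable_funTS => _ B mB.
by rewrite setTI; apply: sub_sigma_fieldS; exact: mY.
Qed.

Lemma sub_sigma_fieldI A B : G A -> G B -> G (A `&` B).
Proof. by rewrite !sub_sigma_field_measurableE; exact: measurableI. Qed.

Lemma sub_sigma_fieldT : G setT.
Proof. by rewrite sub_sigma_field_measurableE; exact: measurableT. Qed.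

(** An indicator is integrable under a probability, so the defining identity holds on every set of
    [G]. *)
Lemma is_cond_prob_integral (E : set T) (q : T -> R) : is_cond_prob P G E q ->
  [/\ measurable E, measurable_wrt G q, P.-integrable setT (EFin \o q) &
    forall A, G A -> (\int[P]_(t in A) (q t)%:E = P (E `&` A))%E].
Proof.
move=> [mq [A [GA AT iA]] Eq].
have mE : measurable E.
  (* Measurability of [E] is recovered from the cover: on each [A k], [E] is the level set at 1 of a
     measurable function. *)
  rewrite -(setIT E) -AT setI_bigcupr; apply: bigcup_measurable => k _.
  have /integrableP[/measurable_EFinP mf _] := iA k.
  have := mf (sub_sigma_fieldS (GA k)) [set 1] (measurable_set1 1).
  congr measurable; rewrite setIC; congr (_ `&` _).
  apply/seteqP; split => t /=; last by move=> Et; rewrite indicE mem_set.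
  by rewrite indicE; case: (boolP (t \in E)) => [/set_mem//|_ /esym/eqP];
    rewrite oner_eq0.
have iE : P.-integrable setT (EFin \o \1_E) by exact: integrable_indic.
have [iq _] := Eq _ sub_sigma_fieldT iE; split => // B GB.
have mB := sub_sigma_fieldS GB.
by rewrite (Eq _ GB _).2 ?integral_indic//; exact: (integrableS measurableT).
Qed.

(* For indicators this is the definition of conditional probability; simple
   functions and monotone convergence give the rest. *)
Lemma is_cond_prob_pull_out_ge0 (E A : set T) (q h : T -> R) :
  is_cond_prob P G E q -> (forall t, 0 <= q t) ->
  measurable_wrt G h -> (forall t, 0 <= h t) -> G A ->
  (\int[P]_(t in A) (h t * q t)%:E = \int[P]_(t in A) (h t * \1_E t)%:E)%E.
Proof.
move=> /is_cond_prob_integral[mE mq iq Eq] q0 mh h0 GA.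
have mA := sub_sigma_fieldS GA.
have mhG : measurable_fun [set: TG] (EFin \o h).
  by apply/measurable_EFinP/measurable_wrtP.
(* Approximating on [TG] puts the level sets of the simple functions in [G]. *)
pose phi := nnsfun_approx measurableT mhG.
pose psi k : T -> R := (phi k : TG -> R).
have psi0 k t : 0 <= psi k t by exact: (@fun_ge0 _ _ (phi k)).
have mpsi k : measurable_wrt G (psi k).
  by apply/measurable_wrtP; exact: measurable_funTS.
have fpsi k : finite_set (range (psi k)) by exact: (fimfunP (phi k)).
have mE1 : measurable_fun A (\1_E : T -> R) by exact: measurable_indic.
have mq1 : measurable_fun A q by exact: measurable_wrt_measurable.
have lim (r : T -> R) : (forall t, 0 <= r t) -> measurable_fun A r ->
    (\int[P]_(t in A) (psi k t * r t)%:E)%E @[k --> \oo]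
      --> (\int[P]_(t in A) (h t * r t)%:E)%E.
  move=> r0 mr.
  have : (\int[P]_(t in A) (psi k t * r t)%:E)%E @[k --> \oo]
      --> (\int[P]_(t in A) limn (fun k => (psi k t * r t)%:E))%E.
    apply: cvg_monotone_convergence => //.
    - move=> k; apply/measurable_EFinP/measurable_funM => //.
      exact: measurable_wrt_measurable.
    - by move=> k t _; rewrite lee_fin mulr_ge0.
    - move=> t _ k l kl; rewrite lee_fin ler_wpM2r//.
      by have /lefP := nd_nnsfun_approx measurableT mhG kl; exact.
  congr (_ --> _); apply: eq_integral => t _; apply/cvg_lim => //.
  under eq_fun do rewrite EFinM.
  rewrite EFinM; apply: cvgeZr => //.
  exact: (@cvg_nnsfun_approx _ TG R setT measurableT _ mhG (fun t _ => h0 t) t).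
have mindic k y (r : T -> R) : measurable_fun A r ->
    measurable_fun A (fun t => \1_(psi k @^-1` [set y]) t * r t).
  move=> mr; apply: measurable_funM => //; apply: measurable_indic.
  by apply: sub_sigma_fieldS; exact: mpsi.
(* The maximum covers negative [y], whose level set is empty because [psi k] is nonnegative. *)
have level k y (r : T -> R) : (forall t, 0 <= r t) -> measurable_fun A r ->
    (\int[P]_(t in A) (y * \1_(psi k @^-1` [set y]) t * r t)%:E =
     (Num.max y 0)%:E * \int[P]_(t in A `&` (psi k @^-1` [set y])) (r t)%:E)%E.
  move=> r0 mr; have [y0|y0] := leP 0 y; last first.
    rewrite mul0e; apply: integral0_eq => t _; rewrite indicE.
    case: (boolP (t \in _)) => [/set_mem/= ty|_]; last by rewrite mulr0 mul0r.
    by move: (psi0 k t); rewrite ty leNgt y0.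
  under eq_integral do rewrite -mulrA EFinM.
  rewrite ge0_integralZl_EFin//; last exact/measurable_EFinP/mindic.
    congr (_ * _)%E; rewrite integral_mkcondr; apply: eq_integral => t _.
    by rewrite patchE indicE; case: ifP; rewrite ?mul1r ?mul0r.
  by move=> t _; rewrite lee_fin mulr_ge0.
have psi_sum k (r : T -> R) : (forall t, 0 <= r t) -> measurable_fun A r ->
    (\int[P]_(t in A) (psi k t * r t)%:E =
     \sum_(y \in range (psi k))
       \int[P]_(t in A) (y * \1_(psi k @^-1` [set y]) t * r t)%:E)%E.
  move=> r0 mr; rewrite -ge0_integral_fsum//.
  - apply: eq_integral => t _; rewrite fsumEFin//.
    by rewrite -mulr_fsuml// -(fimfunE (phi k) t).
  - move=> y; apply/measurable_EFinP.
    under eq_fun do rewrite -mulrA.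
    by apply: measurable_funM => //; exact: mindic.
  - move=> y t _; rewrite lee_fin mulr_ge0// indicE.
    case: (boolP (t \in _)) => [/set_mem/= <-|_]; last by rewrite mulr0.
    by rewrite mulr1.
have psi_eq k : (\int[P]_(t in A) (psi k t * q t)%:E =
    \int[P]_(t in A) (psi k t * \1_E t)%:E)%E.
  rewrite !psi_sum//; apply: eq_fsbigr => y _; rewrite !level//; congr (_ * _)%E.
  have GB : G (A `&` psi k @^-1` [set y]).
    by apply: sub_sigma_fieldI => //; exact: mpsi.
  by rewrite Eq// integral_indic//; exact: sub_sigma_fieldS.
have := lim q q0 mq1; rewrite (funext psi_eq) => limq.
by apply: (cvg_unique _ limq); [exact: ereal_hausdorff|exact: lim].
Qed.

(** The nonnegative case for the absolute value of [h] transfers integrability; for its positive and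
    negative parts it gives the equality. *)
Lemma is_cond_prob_pull_out (E A : set T) (q h : T -> R) :
  is_cond_prob P G E q -> (forall t, 0 <= q t) ->
  measurable_wrt G h -> G A ->
  P.-integrable A (fun t => (h t * \1_E t)%:E) ->
  P.-integrable A (fun t => (h t * q t)%:E) /\
  (\int[P]_(t in A) (h t * q t)%:E = \int[P]_(t in A) (h t * \1_E t)%:E)%E.
Proof.
move=> Eq q0 mh GA /integrableP[mhE ihE].
have mA := sub_sigma_fieldS GA.
have [mE mq _ _] := is_cond_prob_integral Eq.
have mh' : measurable_fun [set: TG] h by apply/measurable_wrtP.
have mhp : measurable_wrt G h^\+ by apply/measurable_wrtP/measurable_funrpos.
have mhn : measurable_wrt G h^\- by apply/measurable_wrtP/measurable_funrneg.
have mha : measurable_wrt G (fun t => `|h t|).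
  by apply/measurable_wrtP; exact: measurableT_comp.
have E1_ge0 t : 0 <= \1_E t :> R by [].
have split_int (r : T -> R) : (forall t, 0 <= r t) -> measurable_fun A r ->
    P.-integrable A (fun t => (h t * r t)%:E) ->
    (\int[P]_(t in A) (h t * r t)%:E = \int[P]_(t in A) (h^\+ t * r t)%:E
      - \int[P]_(t in A) (h^\- t * r t)%:E)%E.
  move=> r0 mr ir; rewrite -integralB_EFin//.
  - by apply: eq_integral => t _; rewrite -EFinB -mulrBl -[in LHS](funrposBneg h).
  - apply: le_integrable ir => //.
      apply/measurable_EFinP/measurable_funM => //.
      exact: measurable_wrt_measurable.
    move=> t _; rewrite lee_fin !normrM ler_wpM2r//.
    by rewrite ger0_norm ?funrpos_ge0// /funrpos ge_max ler_norm normr_ge0.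
  - apply: le_integrable ir => //.
      apply/measurable_EFinP/measurable_funM => //.
      exact: measurable_wrt_measurable.
    move=> t _; rewrite lee_fin !normrM ler_wpM2r//.
    by rewrite ger0_norm ?funrneg_ge0// /funrneg ge_max -normrN ler_norm normr_ge0.
have mqA : measurable_fun A q by exact: measurable_wrt_measurable.
have iq : P.-integrable A (fun t => (h t * q t)%:E).
  apply/integrableP; split.
    apply/measurable_EFinP/measurable_funM => //.
    exact: measurable_wrt_measurable.
  under eq_integral => t _ do rewrite /= normrM (ger0_norm (q0 t)).
  rewrite (is_cond_prob_pull_out_ge0 Eq)//.
  under eq_integral => t _ do rewrite -(ger0_norm (E1_ge0 t)) -normrM.
  exact: ihE.
have iE : P.-integrable A (fun t => (h t * \1_E t)%:E) by exact/integrableP.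
split=> //; rewrite (split_int _ q0)// (split_int _ E1_ge0 _ iE)//.
by rewrite !(is_cond_prob_pull_out_ge0 Eq).
Qed.

(** On the part of [A k] where [Y2 < Y1], a set of [G], both versions have the integral of [Z]. The
    positive difference integrates to 0, so this part is null. The cover is used because [Z] need
    only be integrable piecewise. *)
Lemma is_cond_exp_le (Z Y1 Y2 : T -> R) :
  is_cond_exp P G Z Y1 -> is_cond_exp P G Z Y2 -> {ae P, forall t, Y1 t <= Y2 t}.
Proof.
move=> [mY1 [A [GA AT iA]] ZY1] [mY2 _ ZY2].
pose B k := A k `&` [set t | Y2 t < Y1 t].
have mY12 : measurable_wrt G (fun t => Y1 t - Y2 t).
  by apply/measurable_wrtP/measurable_funB; apply/measurable_wrtP.
have GB k : G (B k).
  apply: sub_sigma_fieldI => //.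
  have := mY12 `]0, +oo[%classic (measurable_itv _).
  congr G; apply/seteqP; split => t /=; rewrite in_itv/= andbT subr_gt0//.
have mB k := sub_sigma_fieldS (GB k).
have iB k : P.-integrable (B k) (EFin \o Z).
  by apply: integrableS (iA k) => //; [exact: sub_sigma_fieldS|exact: subIsetl].
have : forall k, {ae P, forall t, B k t -> (Y1 t - Y2 t)%:E = 0%E}.
  move=> k; have [i1 e1] := ZY1 _ (GB k) (iB k).
  have [i2 e2] := ZY2 _ (GB k) (iB k).
  apply/(ae_eq_integral_abs P (mB k) (f := fun t => (Y1 t - Y2 t)%:E)).
    by apply/measurable_EFinP; exact: measurable_wrt_measurable.
  transitivity (\int[P]_(t in B k) ((Y1 t)%:E - (Y2 t)%:E))%E.
    apply: eq_integral => t /set_mem[_ /= lt12].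
    by rewrite /= ger0_norm// subr_ge0 ltW.
  rewrite integralB_EFin// e1 e2 subee//.
  exact: integrable_fin_num.
move/ae_foralln; apply: filterS => t h; rewrite leNgt; apply/negP => lt12.
have [k _ Akt] : (\bigcup_k A k) t by rewrite AT.
have [/eqP] := h k (conj Akt lt12).
by rewrite subr_eq0 gt_eqF.
Qed.

Lemma is_cond_exp_unique (Z Y1 Y2 : T -> R) :
  is_cond_exp P G Z Y1 -> is_cond_exp P G Z Y2 -> {ae P, forall t, Y1 t = Y2 t}.
Proof.
move=> h1 h2; have := is_cond_exp_le h1 h2; have := is_cond_exp_le h2 h1.
by apply: filterS2 => t le21 le12; apply/eqP; rewrite eq_le le12 le21.
Qed.

Lemma cond_expP (Z Y : T -> R) : is_cond_exp P G Z Y ->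
  is_cond_exp P G Z (cond_exp P G Z).
Proof. by move=> h; apply: xgetPex; exists Y. Qed.

(** * Functions of a finite-valued variable with known conditional law *)

Section finite_law.
Variables (S : finType) (K : T -> S) (q : S -> T -> R).
Hypothesis Kq : forall s, is_cond_prob P G [set t | K t = s] (q s).
Hypothesis q0 : forall s t, 0 <= q s t.

(** The variable is the sum over [s] of [g s] times the indicator of [K = s]; each [g s] is pulled
    out of its conditional probability. *)
Lemma is_cond_exp_finite (g : S -> T -> R) :
  (forall s, measurable_wrt G (g s)) ->
  is_cond_exp P G (fun t => g (K t) t) (fun t => \sum_s q s t * g s t).
Proof.
move=> mg; set Z := fun t => g (K t) t.
pose E s := [set t | K t = s].
have E1 s t : \1_(E s) t = (K t == s)%:R :> R.
  rewrite indicE; congr ((nat_of_bool _)%:R); apply/idP/eqP => [/set_mem//|Kts].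
  exact/mem_set.
have ZE : Z = (fun t => \sum_s g s t * \1_(E s) t).
  apply/funext => t; rewrite (bigD1 (K t))//= E1 eqxx mulr1 big1 ?addr0// => s.
  by rewrite eq_sym E1 => /negbTE ->; rewrite mulr0.
have mq s : measurable_wrt G (q s) by have [] := is_cond_prob_integral (Kq s).
have mE s : measurable (E s) by have [] := is_cond_prob_integral (Kq s).
have mgE s (A : set T) : measurable_fun A (fun t => g s t * \1_(E s) t).
  apply: measurable_funM; first exact: measurable_wrt_measurable.
  exact: measurable_indic.
split.
- apply/measurable_wrtP; apply: measurable_sum => s.
  by apply: measurable_funM; apply/measurable_wrtP.
(* No moment is assumed on [g]: the sets where the sum of the absolute values is at most [k] lie in
   [G], cover the space, and bound the variable. *)
- pose N t := \sum_s `|g s t|.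
  have mN : measurable_wrt G N.
    apply/measurable_wrtP; apply: measurable_sum => s.
    by apply: measurableT_comp => //; exact/measurable_wrtP.
  pose A (k : nat) := N @^-1` `]-oo, k%:R].
  have GA k : G (A k) by apply: mN; exact: measurable_itv.
  exists A; split => // [|k].
    rewrite -subTset => t _; exists (Num.bound (N t)) => //=.
    by rewrite /A/= in_itv/= ltW// archi_boundP// sumr_ge0.
  have mA := sub_sigma_fieldS (GA k).
  apply: measurable_bounded_integrable => //.
  + by rewrite (le_lt_trans (probability_le1 _ _))// ltry.
  + by rewrite ZE; exact: measurable_sum.
  exists k%:R; split; first exact: num_real.
  move=> M kM t /=; rewrite /A/= in_itv/= => Nk; apply: le_trans (ltW kM).
  by apply: le_trans Nk; rewrite /N (bigD1 (K t))//= lerDl sumr_ge0.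
- move=> A GA iZ; have mA := sub_sigma_fieldS GA.
  (* Each term is dominated by the whole, which equals [g s] where [K = s]. *)
  have igE s : P.-integrable A (fun t => (g s t * \1_(E s) t)%:E).
    apply: le_integrable iZ => //; first exact/measurable_EFinP.
    move=> t _; rewrite lee_fin E1 /Z; case: eqP => [->|_].
      by rewrite mulr1.
    by rewrite mulr0 normr0.
  have pull s := is_cond_prob_pull_out (Kq s) (q0 s) (mg s) GA (igE s).
  set Y := fun t => \sum_s q s t * g s t.
  have YE : EFin \o Y =
      (fun t => \sum_s (g s t * q s t)%:E)%E.
    apply/funext => t /=; rewrite sumEFin; congr _%:E.
    by apply: eq_bigr => s _; rewrite mulrC.
  have ZE' : EFin \o Z = (fun t => \sum_s (g s t * \1_(E s) t)%:E)%E.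
    by rewrite ZE; apply/funext => t /=; rewrite sumEFin.
  split; first by rewrite YE; apply: integrable_sum => // s _; exact: (pull s).1.
  rewrite -[LHS]/(\int[P]_(t in A) (EFin \o Y) t)%E YE.
  rewrite -[RHS]/(\int[P]_(t in A) (EFin \o Z) t)%E ZE'.
  rewrite !integral_sum// => [|s]; last exact: (pull s).1.
  by apply: eq_bigr => s _; exact: (pull s).2.
Qed.

(* [cond_exp] is itself measurable with respect to G, so the squared deviation
   is again a function of K with G-measurable values. *)
Lemma cond_var_finite (g : S -> T -> R) :
  (forall s, measurable_wrt G (g s)) ->
  {ae P, forall t, cond_var P G (fun t => g (K t) t) t =
                   weighted_var (q ^~ t) (g ^~ t)}.
Proof.
move=> mg; set Z := fun t => g (K t) t.
have EZ := is_cond_exp_finite mg; have CZ := cond_expP EZ.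
have mY : measurable_wrt G (cond_exp P G Z) by case: CZ.
have EV : is_cond_exp P G (fun t => (Z t - cond_exp P G Z t) ^+ 2)
    (fun t => \sum_s q s t * (g s t - cond_exp P G Z t) ^+ 2).
  apply: (is_cond_exp_finite (g := fun s t => (g s t - cond_exp P G Z t) ^+ 2)).
  move=> s; apply/measurable_wrtP; apply: measurable_funX.
  by apply: measurable_funB; apply/measurable_wrtP.
have := is_cond_exp_unique (cond_expP EV) EV.
have := is_cond_exp_unique CZ EZ.
apply: filterS2 => t e1 e2; rewrite /cond_var e2 /weighted_var.
by apply: eq_bigr => s _; rewrite e1.
Qed.

End finite_law.
End sub_sigma_field_theory.

(** * Elementary properties of the residual weights *)

Section residual_weights.
Context {d : measure_display} {T : measurableType d} {R : realType}.
Variables (m n : nat) (w : 'I_m -> T -> R).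
Hypotheses (w_ge0 : forall j t, 0 <= w j t) (w_sum1 : forall t, \sum_j w j t = 1).

Lemma floor_copies_le j t : (floor_copies n w j t)%:R <= n%:R * w j t.
Proof. by rewrite truncn_le mulr_ge0. Qed.

Lemma nb_floor_le t : (nb_floor n w t <= n)%N.
Proof.
rewrite -(ler_nat R) natr_sum.
rewrite [leRHS](_ : _ = \sum_j n%:R * w j t); last first.
  by rewrite -mulr_sumr w_sum1 mulr1.
by apply: ler_sum => j _; exact: floor_copies_le.
Qed.

Lemma residual_weight_ge0 t j : 0 <= residual_weight n w t j.
Proof. by rewrite divr_ge0 ?subr_ge0 ?floor_copies_le. Qed.

Lemma residual_weight_le t j :
  (n - nb_floor n w t)%:R * residual_weight n w t j <= n%:R * w j t.
Proof.
have [->|N0] := eqVneq (n - nb_floor n w t)%N 0%N.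
  by rewrite mul0r mulr_ge0.
by rewrite mulrC divfK ?pnatr_eq0// gerBl.
Qed.

Lemma residual_weight_sum1 t : (0 < n - nb_floor n w t)%N ->
  \sum_j residual_weight n w t j = 1.
Proof.
move=> N0; rewrite -mulr_suml sumrB -mulr_sumr w_sum1 mulr1 -natr_sum.
by rewrite -natrB ?nb_floor_le// divff// pnatr_eq0 -lt0n.
Qed.

End residual_weights.

(** * The two conditional variances in closed form *)

Section conditional_variances.
Context {d : measure_display} {T : measurableType d} {R : realType}.
Variables (P : probability T R) (G : set (set T)) (hG : sub_sigma_field G).
Variables (m n : nat) (w h : 'I_m -> T -> R).
Hypotheses (mw : forall j, measurable_wrt G (w j))
  (mh : forall j, measurable_wrt G (h j)).
Hypotheses (w_ge0 : forall j t, 0 <= w j t) (w_sum1 : forall t, \sum_j w j t = 1).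

Lemma cond_var_multinomial (I : 'I_n -> T -> 'I_m) :
  multinomial_resampling P G w I ->
  {ae P, forall t, cond_var P G (fun t => n%:R^-1 * \sum_i h (I i t) t) t =
    n%:R^-1 ^+ 2 * (n%:R * weighted_var (w ^~ t) (h ^~ t))}.
Proof.
move=> [Iw Iind].
pose K t := [ffun i => I i t].
pose g (s : {ffun 'I_n -> 'I_m}) t := n%:R^-1 * \sum_i h (s i) t.
have Kw s : is_cond_prob P G [set t | K t = s] (fun t => \prod_i w (s i) t).
  (* Fixing the whole word is a joint event on singletons, so the product rule gives its conditional
     probability. *)
  have -> : [set t | K t = s] = [set t | forall i, I i t \in [set s i]%SET].
    apply/seteqP; split => t /=; first by move=> <- i; rewrite ffunE inE.
    by move=> Is; apply/ffunP => i; rewrite ffunE; have /set1P := Is i.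
  apply: (Iind (fun i => [set s i]%SET) (fun i => w (s i))) => i.
  rewrite (_ : [set t | _] = [set t | I i t = s i])//.
  by apply/seteqP; split => t /=; rewrite inE => /eqP.
have w0 (s : {ffun 'I_n -> 'I_m}) t : 0 <= \prod_i w (s i) t.
  by rewrite prodr_ge0.
have mg s : measurable_wrt G (g s).
  apply/(measurable_wrtP hG)/measurable_funM => //.
  by apply: measurable_sum => i; exact/(measurable_wrtP hG).
have := cond_var_finite hG Kw w0 mg.
rewrite (_ : (fun t => g (K t) t) = (fun t => n%:R^-1 * \sum_i h (I i t) t)).
  by apply: filterS => t ->; exact: (word_var (h ^~ t) _ (w_sum1 t)).
by apply/funext => t; rewrite /g; under eq_bigr do rewrite ffunE.
Qed.

Lemma cond_var_residual (I : 'I_n -> T -> 'I_m) :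
  residual_resampling P G w I ->
  {ae P, forall t, cond_var P G (fun t => n%:R^-1 * \sum_i h (I i t) t) t =
    n%:R^-1 ^+ 2 * ((n - nb_floor n w t)%:R *
      weighted_var (residual_weight n w t) (h ^~ t))}.
Proof.
move=> [Nbar [NbarE Nbar_law]].
(* A residual count is at most the number of positions carrying label [j], hence at most n; this
   makes the count vector finite-valued. *)
have Nbar_le t j : (Nbar j t < n.+1)%N.
  rewrite ltnS (leq_trans (leq_addl (floor_copies n w j t) _))// -NbarE.
  by rewrite -[leqRHS]card_ord max_card.
pose K t : {ffun 'I_m -> 'I_n.+1} := [ffun j => inord (Nbar j t)].
pose g (k : {ffun 'I_m -> 'I_n.+1}) t := n%:R^-1 *
  (\sum_j (floor_copies n w j t)%:R * h j t + \sum_j (k j)%:R * h j t).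
pose q (k : {ffun 'I_m -> 'I_n.+1}) t :=
  multinomial_pmf (n - nb_floor n w t) (residual_weight n w t) (fun j => k j).
have Kq k : is_cond_prob P G [set t | K t = k] (q k).
  rewrite (_ : [set t | _] = [set t | forall j, Nbar j t = k j])//.
  apply/seteqP; split => t /=; first by move=> <- j; rewrite ffunE inordK.
  by move=> Nk; apply/ffunP => j; rewrite ffunE Nk inord_val.
have q0 k t : 0 <= q k t.
  by apply: multinomial_pmf_ge0 => j; exact: residual_weight_ge0.
(* The floor is monotone, hence measurable, so the deterministic copy counts are measurable with
   respect to [G]. *)
have mtruncn : measurable_fun [set: R] (fun x : R => (Num.truncn x)%:R : R).
  apply: nondecreasing_measurable => // x y xy.
  by rewrite ler_nat le_truncn.
have mg k : measurable_wrt G (g k).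
  apply/(measurable_wrtP hG)/measurable_funM => //; apply: measurable_funD;
    apply: measurable_sum => j; apply: measurable_funM => //;
    try exact/(measurable_wrtP hG).
  apply: (measurableT_comp mtruncn); apply: measurable_funM => //.
  exact/(measurable_wrtP hG).
have := cond_var_finite hG Kq q0 mg.
rewrite (_ : (fun t => g (K t) t) = (fun t => n%:R^-1 * \sum_i h (I i t) t)).
  apply: filterS => t ->.
  apply: (multinomial_var (h ^~ t)); first exact: leq_subr.
  exact: residual_weight_sum1.
apply/funext => t; rewrite /g -big_split/=; congr (_ * _).
(* Positions are grouped by label: only the number of copies of each label is known, and the sum
   depends on nothing else. *)
rewrite [RHS](partition_big (I^~ t) predT)//=; apply: eq_bigr => j _.
rewrite (eq_bigr (fun=> h j t)) => [|i /eqP -> //].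
by rewrite sumr_const NbarE ffunE inordK// -mulrDl -natrD mulr_natl.
Qed.

End conditional_variances.

Theorem mainTheorem1 (d : measure_display) (T : measurableType d)
  (R : realType) (P : probability T R)
  (G : set (set T)) (hG : sub_sigma_field G)
  (m n : nat) (hm : (1 <= m)%N) (hn : (1 <= n)%N)
  (X : Type) (f : X -> R)
  (xi : 'I_m -> T -> X) (w : 'I_m -> T -> R)
  (hxi : forall i, measurable_wrt G (fun t => f (xi i t)))
  (hw : forall i, measurable_wrt G (w i))
  (w_ge0 : forall i t, 0 <= w i t)
  (w_sum1 : forall t, \sum_(i < m) w i t = 1)
  (Ires Imult : 'I_n -> T -> 'I_m)
  (hres : residual_resampling P G w Ires)
  (hmult : multinomial_resampling P G w Imult) :
  {ae P, forall t,
    cond_var P G (empirical_mean f (resampled xi Ires)) t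
      <= cond_var P G (empirical_mean f (resampled xi Imult)) t}.
Proof.
have := cond_var_multinomial hG hxi w_ge0 w_sum1 hmult.
have := cond_var_residual hG hw hxi w_ge0 w_sum1 hres.
apply: filterS2 => t res_eq mult_eq.
rewrite /empirical_mean /resampled res_eq mult_eq ler_wpM2l ?sqr_ge0//.
apply: weighted_var_residual => //.
- by rewrite ltr0n; exact: residual_weight_sum1.
- by move=> j; exact: residual_weight_le.
Qed.
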